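(* Let $n,r\in\mathbb N$ with $r\geq 3$ and $r$ dividing $n$. Let $D\in\mathbb N$ with $r-1\leq D\leq (r-1)n/r-1$, and define $$g(n,r,D):=\max\left\{\binom{n}{2}-\binom{n/r+1}{2},\; D(n-D)+\binom{n-1-D}{2}+e(T(D,r-2))\right\}.$$ If $G$ is a graph on $n$ vertices with $\delta(G)\geq D$ and $e(G)>g(n,r,D)$, then $G$ contains a perfect $K_r$-packing. Moreover, there exists a graph $G'$ on $n$ vertices with $\delta(G')\geq D$ and $e(G')=g(n,r,D)$ which does not contain a perfect $K_r$-packing.
   Context: For a graph $H$, a perfect $H$-packing in $G$ is a collection of vertex-disjoint copies of $H$ in $G$ covering all vertices of $G$. $T(m,s)$ denotes the Turán graph: the complete $s$-partite graph on $m$ vertices whose vertex classes have sizes $\lfloor m/s\rfloor$ or $\lceil m/s\rceil$ (for $s=1$ this is the edgeless graph on $m$ vertices). $e(\cdot)$ denotes the number of edges and $\delta(\cdot)$ the minimum degree. *)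

(* Defs.v *)
From mathcomp Require Import all_boot.

Set Implicit Arguments.
Unset Strict Implicit.
Unset Printing Implicit Defensive.

Record sgraph := SGraph {
  vertex :> finType;
  adj : rel vertex;
  adj_sym : symmetric adj;
  adj_irr : irreflexive adj }.

Definition edges (G : sgraph) : {set {set G}} :=
  [set E : {set G} | [exists x : G, exists y : G, adj x y && (E == [set x; y])]].

Definition num_edges (G : sgraph) : nat := #|edges G|.

Definition degree (G : sgraph) (x : G) : nat := #|[set y : G | adj x y]|.

(* All degrees are smaller than #|G|, so the default value #|G| of the
   iterated minimum only matters for the graph without vertices. *)
Definition min_degree (G : sgraph) : nat := \big[minn/#|G|]_(x : G) degree x.

Definition embedding (H G : sgraph) (f : H -> G) : Prop :=
  injective f /\ (forall x y : H, adj x y -> adj (f x) (f y)).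

(* Copies of H in G are not required to be induced; each is given by an
   embedding, whose image is the vertex set of the copy. *)
Definition has_perfect_packing (H G : sgraph) : Prop :=
  exists (k : nat) (f : 'I_k -> H -> G),
    [/\ forall i, embedding (f i),
        forall i j, i != j -> [disjoint codom (f i) & codom (f j)]
      & forall x : G, exists i, x \in codom (f i)].

Definition complete_adj (r : nat) : rel 'I_r := fun i j => i != j.

Lemma complete_adj_sym r : symmetric (@complete_adj r).
Proof. by move=> i j; rewrite /complete_adj eq_sym. Qed.

Lemma complete_adj_irr r : irreflexive (@complete_adj r).
Proof. by move=> i; rewrite /complete_adj eqxx. Qed.

Definition complete_graph (r : nat) : sgraph :=
  SGraph (@complete_adj_sym r) (@complete_adj_irr r).

Definition turan_adj (m s : nat) : rel 'I_m := fun i j => i %% s != j %% s.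

Lemma turan_adj_sym m s : symmetric (@turan_adj m s).
Proof. by move=> i j; rewrite /turan_adj eq_sym. Qed.

Lemma turan_adj_irr m s : irreflexive (@turan_adj m s).
Proof. by move=> i; rewrite /turan_adj eqxx. Qed.

(* For 0 < s, the vertex classes are the residue classes modulo s in
   {0, ..., m-1}; their sizes are given by turan_class_size. *)
Definition turan_graph (m s : nat) : sgraph :=
  SGraph (@turan_adj_sym m s) (@turan_adj_irr m s).

Lemma turan_class_size (m s c : nat) : c < s ->
  #|[set i : turan_graph m s | i %% s == c]| = m %/ s + (c < m %% s).
Proof.
move=> lt_cs; have s_gt0 : 0 < s by apply: leq_ltn_trans lt_cs.
rewrite -sum1_card; under eq_bigl do rewrite inE.
rewrite /= -(big_mkord (fun i => i %% s == c) (fun=> 1)).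
elim: m => [|m IHm]; first by rewrite big_geq // div0n mod0n.
rewrite big_mkcond big_nat_recr //= -big_mkcond IHm.
rewrite [in RHS](divn_eq m s) -addnS divnMDl // modnMDl.
have := ltn_pmod m s_gt0; rewrite leq_eqVlt => /predU1P [ms|lt_ms].
  rewrite ms divnn s_gt0 modnn.
  have [->|ne] := eqVneq (m %% s) c; first by rewrite ltnn; rewrite !addn0.
  have lt_c : c < m %% s by rewrite ltn_neqAle eq_sym ne -ltnS ms.
  by rewrite lt_c ltn0 !addn0.
rewrite (divn_small lt_ms) (modn_small lt_ms) addn0 -addnA ltnS.
by congr (_ + _); case: ltngtP.
Qed.

(* For r dividing n and D <= (r - 1)n/r - 1, the divisions are exact and no
   subtraction is truncated. *)
Definition g (n r D : nat) : nat :=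
  maxn ('C(n, 2) - 'C(n %/ r + 1, 2))
       (D * (n - D) + 'C(n - 1 - D, 2) + num_edges (turan_graph D (r - 2))).

(* Main.v *)
Require Import Defs.
From mathcomp Require Import all_boot zify.

Set Implicit Arguments.
Unset Strict Implicit.
Unset Printing Implicit Defensive.

(** Pass to the complement [H] of [G] and write [s = r - 2], [n = k r]: a
perfect [K_r]-packing of [G] is a partition of [H] into [k] independent
[r]-sets, and the edge condition says that [H] has fewer than ['C(k + 1, 2)]
edges and fewer than [d(x) + coturan (n - 1 - d(x)) s] edges for every vertex
[x].  Induct on [k], removing one independent [r]-set [S] so that both bounds
survive.  If all degrees in [H] are less than [k], a greedy choice gives [S]
with degree sum at least [2 e(H) / k], and the second bound becomes vacuous.
Otherwise let [v] have maximum degree; by Turan's theorem the non-neighbourhood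
of [v] contains an independent [(r - 1)]-set.  If some independent [r]-set
contains two vertices of maximum degree, take it as [S].  If not, an exchange
argument shows that removing [v] and such an [(r - 1)]-set lowers the maximum
degree.  In both cases a violation of the second bound contradicts the bounds
for [H] by convexity of [coturan]. *)

(** * Missing edges of Turán graphs: recurrences, convexity and estimates *)

(* The number of edges of the complement of [T(p, s)]; see [num_edges_turan]. *)
Definition coturan (p s : nat) : nat := \sum_(i < p) i %/ s.

Lemma coturan0 s : coturan 0 s = 0.
Proof. by rewrite /coturan big_ord0. Qed.

Lemma coturanS p s : coturan p.+1 s = coturan p s + p %/ s.
Proof. by rewrite /coturan big_ord_recr. Qed.

Lemma leq_coturan p q s : p <= q -> coturan p s <= coturan q s.
Proof.
move=> /subnK <-; elim: (q - p) => // m IHm.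
by rewrite addSn coturanS (leq_trans IHm) ?leq_addr.
Qed.

(** One new vertex in each of the [s] classes meets, over all classes, each of the [p] old vertices
    exactly once. *)
Lemma coturan_shift p s : 0 < s -> coturan (p + s) s = coturan p s + p.
Proof.
move=> s_gt0; elim: p => [|p IHp].
  by rewrite coturan0 /coturan big1 // => i _; rewrite divn_small.
by rewrite addSn !coturanS IHp divnDr // divnn s_gt0; lia.
Qed.

Lemma coturan_block q t s : 0 < s -> t <= s ->
  coturan (q * s + t) s = coturan (q * s) s + t * q.
Proof.
move=> s_gt0; elim: t => [|t IHt] lt_ts; first by rewrite !addn0.
rewrite addnS coturanS IHt 1?ltnW // divnMDl // divn_small //; lia.
Qed.

Lemma coturan_mul q s : 0 < s -> 2 * coturan (q * s) s + s * q = s * q * q.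
Proof.
move=> s_gt0; elim: q => [|q IHq]; first by rewrite mul0n coturan0 !muln0.
rewrite (mulSnr q) coturan_block //; nia.
Qed.

(** The right side counts the missing edges of an [s.+1]-partite graph with one class of size [a],
    so it is at least the Turán value. The induction deletes a vertex of that class if [a] exceeds
    [q], and one of the other [b] vertices otherwise. The side condition is there because division
    by zero makes [coturan b 0] vanish. *)
Lemma coturan_merge a b s : (0 < s) || (b == 0) ->
  coturan (a + b) s.+1 <= 'C(a, 2) + coturan b s.
Proof.
move: {2}(a + b) (erefl (a + b)) => m; elim: m a b => [|m IHm] a b def_m sb.
  by rewrite def_m coturan0.
have q_def := divn_eq m s.+1; have lt_m := ltn_pmod m (ltn0Sn s).
set q := m %/ s.+1 in q_def.
rewrite def_m coturanS -/q.
have [le_aq|lt_qa] := leqP a q; last first.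
  case: a def_m lt_qa => // a def_m lt_qa.
  have ab : a + b = m by lia.
  by have := IHm a b ab sb; rewrite ab binS bin1; lia.
have b_gt0 : 0 < b by case: (posnP b) => // b0; nia.
have s_gt0 : 0 < s by case/orP: sb => // /eqP b0; rewrite b0 in b_gt0.
case: b def_m b_gt0 sb => // b def_m _ _.
have : q <= b %/ s by rewrite leq_divRL //; nia.
have ab : a + b = m by lia.
by have := IHm a b ab; rewrite ab s_gt0 coturanS => /(_ isT); lia.
Qed.

(** From [p = s] on, every increment [p %/ s] is at least 1. Hence the vertex bound for degree [D]
    in [G] implies the one for every larger degree. *)
Lemma coturan_add_mono p q s : s <= p -> p <= q -> 0 < s ->
  coturan p s + q <= coturan q s + p.
Proof.
move=> le_sp /subnK <- s_gt0; elim: (q - p) => [|m IHm]; first by rewrite !add0n.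
rewrite addSn coturanS.
have : 0 < (m + p) %/ s
  by rewrite divn_gt0 // (leq_trans le_sp) ?leq_addl.
lia.
Qed.

(** Convexity: past [K * s] all increments are at least [K]. *)
Lemma coturan_tangent K m s : 0 < s ->
  coturan (K * s) s + m * K <= coturan (K * s + m) s.
Proof.
move=> s_gt0; elim: m => [|m IHm]; first by rewrite !addn0.
rewrite addnS coturanS divnMDl // mulSnr; move: (m %/ s) => z; lia.
Qed.

(** For a vertex with [p] non-neighbours and degree [d = K * s.+2 - 1 - p], the hypothesis says
    [d <= K] and the conclusion [K * K.+1 <= 2 * d + 2 * coturan p s]: at low degree the vertex
    bound follows from the edge bound. *)
Lemma coturan_low_degree K s p : 0 < s -> 0 < K -> K * s.+1 <= p + 1 ->
  K * K.+1 + 2 * p + 2 <= 2 * (K * s.+2) + 2 * coturan p s.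
Proof.
move=> s_gt0 K_gt0 le_p.
have [m def_p] : exists m, p = K * s + m by exists (p - K * s); nia.
rewrite def_p in le_p *.
have := coturan_tangent K m s_gt0; have := coturan_mul K s_gt0.
set u := coturan _ _; set w := coturan _ _ => uE le_uw.
have : K * K <= s * K * K by nia.
have : m <= m * K by nia.
have : K * K - K <= s * K * K - s * K by nia.
have : (K - 1) * K.-1 <= m * K.-1 by nia.
nia.
Qed.

(** If at least [d + coturan p s] edges remain after a removal that destroyed at least [d + 1],
    there were at least ['C(K.+2, 2)] to begin with. *)
Lemma coturan_high_degree K s p d : 0 < s -> 1 < K -> d + p + 1 = K * s.+2 ->
  d <= p + p %/ s -> K.+1 * K.+2 <= 4 * d + 2 * coturan p s + 2.
Proof.
move=> s_gt0 K_gt1 def_d le_d.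
have p_def := divn_eq p s; have lt_t := ltn_pmod p s_gt0.
move: (p %/ s) (p %% s) p_def lt_t le_d => q t p_def lt_t le_d.
have tbE : 2 * coturan p s + s * q = s * q * q + 2 * t * q.
  have := coturan_mul q s_gt0.
  rewrite p_def (coturan_block q s_gt0 (ltnW lt_t)); lia.
(* If [K <= q], then [d] is less than [2 * K] and [coturan p s] carries the bound; otherwise
   [d <= p + q] keeps the excess [u] of [K] over [q.+1] at most [q]. *)
have [le_Kq|/subnKC] := leqP K q.
  have q_le : 5 * q + K * (K - 1) <= q * q + 4 * K.
    have {le_Kq} [i ->] : exists i, q = K + i by exists (q - K); lia.
    case: K K_gt1 {def_d} => [|[|j]] // _; case: i => [|i]; nia.
  have sq_le : s * (5 * q + K * (K - 1)) <= s * (q * q + 4 * K).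
    by rewrite leq_mul2l q_le orbT.
  have : 2 * t <= t * q by nia.
  have : K * (K - 1) <= s * (K * (K - 1)) by rewrite leq_pmull.
  nia.
set u := K - q.+1; rewrite addSnnS => def_K.
have le_u : u.+1 * s.+2 + q <= s * q + 2 * t + 1 by nia.
have le_uq : u <= q by nia.
have : q * (u.+1 * s.+2 + q) <= q * (s * q + 2 * t + 1).
  by rewrite leq_mul2l le_u orbT.
have : q * u <= q * u * s by rewrite leq_pmulr.
have : u * u <= u * q by rewrite leq_mul2l le_uq orbT.
have : t <= s * u.+1 by nia.
rewrite -def_K in def_d *; nia.
Qed.

Lemma bin2_double m : 2 * 'C(m, 2) = m * m.-1.
Proof. by rewrite -mul_bin_diag bin1. Qed.

(** * Edge counts and independent sets inside vertex subsets *)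

Section EquitableColoring.

Variables (T : finType) (h : rel T).
Hypotheses (h_sym : symmetric h) (h_irr : irreflexive h).
Implicit Types (A B S U X Y : {set T}) (x y : T).

(** Pairs are ordered, so [pairs A A] is twice the number of edges inside [A]. *)
Definition pairs X Y : nat := \sum_(x in X) \sum_(y in Y) h x y.
Definition deg X x : nat := \sum_(y in X) h x y.
Definition indep S : bool := [forall x in S, forall y in S, ~~ h x y].

Lemma indepP S : reflect {in S &, forall x y, h x y = false} (indep S).
Proof.
apply: (iffP 'forall_in_forall_inP) => hS x y xS yS; last by rewrite hS.
exact/negbTE/hS.
Qed.

Lemma pairsE X Y : pairs X Y = \sum_(x in X) deg Y x. Proof. by []. Qed.

Lemma deg_card X x : deg X x = #|[set y in X | h x y]|.
Proof.
rewrite -sum1_card [RHS](eq_bigl (fun y => (y \in X) && h x y)).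
  by rewrite big_mkcondr; apply: eq_bigr => y _; case: (h x y).
by move=> y; rewrite inE.
Qed.

Lemma deg_sub X Y x : X \subset Y -> deg X x <= deg Y x.
Proof.
move=> sXY; rewrite !deg_card; apply/subset_leq_card/subsetP => y.
by rewrite !inE => /andP[/(subsetP sXY)-> ->].
Qed.

Lemma deg_split X Y x : X \subset Y -> deg Y x = deg X x + deg (Y :\: X) x.
Proof. by move=> /setIidPr sXY; rewrite /deg (big_setID X) /= sXY. Qed.

Lemma deg_eq0 X x : (forall y, y \in X -> h x y = false) -> deg X x = 0.
Proof. by move=> hX; rewrite /deg big1 // => y /hX ->. Qed.

Lemma pairsC X Y : pairs X Y = pairs Y X.
Proof.
rewrite /pairs exchange_big; apply: eq_bigr => y _.
by apply: eq_bigr => x _; rewrite h_sym.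
Qed.

Lemma pairs_split X Y : X \subset Y ->
  pairs Y Y + pairs X X = pairs (Y :\: X) (Y :\: X) + 2 * pairs X Y.
Proof.
move=> sXY; have split_r Z : pairs Z Y = pairs Z X + pairs Z (Y :\: X).
  by rewrite !pairsE -big_split; apply: eq_bigr => x _; apply: deg_split.
have -> : pairs Y Y = pairs X Y + pairs (Y :\: X) Y.
  by rewrite {1}/pairs (big_setID X) /= (setIidPr sXY).
rewrite (pairsC (_ :\: _) Y) (pairsC Y) (split_r X) (split_r (_ :\: _)).
rewrite (pairsC (_ :\: _) X); lia.
Qed.

Lemma pairs_sub X Y : X \subset Y -> pairs X X <= pairs Y Y.
Proof.
move=> sXY; rewrite !pairsE [leqRHS](big_setID X) /= (setIidPr sXY).
by rewrite (leq_trans _ (leq_addr _ _)) // leq_sum // => x _; apply: deg_sub.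
Qed.

Lemma pairs_indep S : indep S -> pairs S S = 0.
Proof.
by move=> /indepP iS; rewrite pairsE big1 // => x xS; apply: deg_eq0 => y; apply: iS.
Qed.

Lemma pairs_remove_indep S A : indep S -> S \subset A ->
  pairs A A = pairs (A :\: S) (A :\: S) + 2 * \sum_(x in S) deg A x.
Proof. by move=> iS /pairs_split; rewrite (pairs_indep iS) addn0. Qed.

Lemma deg_lt_card A x : x \in A -> deg A x < #|A|.
Proof.
move=> xA; rewrite deg_card; apply: proper_card; apply/properP; split.
  by apply/subsetP => y; rewrite inE => /andP[].
by exists x; rewrite // inE h_irr andbF.
Qed.

Lemma pairs_le X : pairs X X <= #|X| * #|X|.-1.
Proof.
rewrite -sum_nat_const pairsE leq_sum // => x /deg_lt_card; lia.
Qed.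

Lemma indep1 x : indep [set x].
Proof. by apply/indepP => y z /set1P -> /set1P ->; apply: h_irr. Qed.

Lemma indepU1 x S : indep S -> (forall y, y \in S -> h x y = false) ->
  indep (x |: S).
Proof.
move=> /indepP iS xS; apply/indepP => y z /setU1P[->|yS] /setU1P[->|zS].
- exact: h_irr.
- exact: xS.
- by rewrite h_sym xS.
- exact: iS.
Qed.

Lemma subset_of_size A m : m <= #|A| -> {B : {set T} | B \subset A & #|B| = m}.
Proof.
move=> le_m; exists [set x in take m (enum A)].
  apply/subsetP => x; rewrite inE => /mem_take; by rewrite mem_enum.
by rewrite cardsE (card_uniqP _) ?take_uniq ?enum_uniq // size_takel // -cardE.
Qed.

(* Induction on [s], removing the closed neighbourhood of a vertex of minimum
   degree, which touches at least ['C(#|N|, 2)] edges. *)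
Lemma turan_indep s A : pairs A A < 2 * coturan #|A| s ->
  exists S : {set T}, [/\ S \subset A, indep S & #|S| = s.+1].
Proof.
elim: s A => [|s IHs] A lt_tb.
  have [A0|] := set_0Vmem A; first by rewrite A0 cards0 coturan0 in lt_tb.
  by case=> x xA; exists [set x]; rewrite sub1set indep1 cards1.
have [A0|[x0 x0A]] := set_0Vmem A; first by rewrite A0 cards0 coturan0 in lt_tb.
case: (@arg_minnP _ x0 (fun x => x \in A) (deg A) x0A) => u uA u_min.
pose N := u |: [set y in A | h u y]; pose B := A :\: N.
have sNA : N \subset A.
  by apply/subsetP => y /setU1P[->//|]; rewrite inE => /andP[].
have cN : #|N| = (deg A u).+1 by rewrite cardsU1 inE h_irr andbF deg_card.
have cA : #|A| = #|N| + #|B| by rewrite -(cardsID N A) (setIidPr sNA).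
(* By minimality of [u], all [#|N|] vertices of [N] have degree at least [#|N| - 1], while [N]
   itself spans at most [2 * 'C(#|N|, 2)] ordered pairs. *)
have le_B : pairs B B + 2 * 'C(#|N|, 2) <= pairs A A.
  have := pairs_split sNA; have := pairs_le N.
  have : #|N| * deg A u <= pairs N A.
    rewrite -sum_nat_const pairsE; apply: leq_sum => y /(subsetP sNA).
    exact: u_min.
  rewrite bin2_double -/B cN /=; lia.
have uB y : y \in B -> h u y = false.
  rewrite !inE negb_or => /andP[/andP[_ nuy] yA].
  by move: nuy; rewrite yA => /negbTE.
have [S [sSB iS cS]] : exists S : {set T}, [/\ S \subset B, indep S
    & #|S| = s.+1].
  (* For [s = 0] and [B] nonempty, [coturan_merge] does not apply, but one vertex of [B] is
     enough. *)
  have [|] := boolP ((0 < s) || (#|B| == 0)).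
    move=> /(coturan_merge #|N|); rewrite -cA => le_tb; apply: IHs; lia.
  rewrite negb_or -eqn0Ngt cards_eq0 => /andP[/eqP-> /set0Pn[y yB]].
  by exists [set y]; rewrite sub1set indep1 cards1.
exists (u |: S); split.
- by rewrite subUset sub1set uA (subset_trans sSB) ?subsetDl.
- by apply: indepU1 => // y /(subsetP sSB)/uB.
- rewrite cardsU1 cS; case: (boolP (u \in S)) => // /(subsetP sSB).
  by rewrite !inE eqxx.
Qed.

(** A vertex [z] of maximum degree is chosen and a block [W] of exactly [k] vertices, containing [z]
    and its neighbours in [U], is discarded. Degrees in the block are at most that of [z], so [k]
    times the degree of [z] pays for it. Degrees are always taken in the fixed set [A]; only [U]
    shrinks. *)
Lemma greedy_indep k i A U : 0 < k -> #|U| = i * k ->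
  (forall x, x \in U -> deg A x < k) -> U \subset A ->
  exists S : {set T}, [/\ S \subset U, indep S, #|S| = i
    & \sum_(x in U) deg A x <= k * \sum_(x in S) deg A x].
Proof.
move=> k_gt0; elim: i U => [|i IHi] U cU lt_k sUA.
  have {cU} -> : U = set0 by apply/eqP; rewrite -cards_eq0 cU.
  exists set0; rewrite sub0set cards0 !big_set0 muln0; split => //.
  by apply/indepP => x y; rewrite inE.
have /set0Pn[x0 x0U] : U != set0 by rewrite -cards_eq0 cU -lt0n muln_gt0.
case: (@arg_maxnP _ x0 (fun x => x \in U) (deg A) x0U) => z zU z_max.
pose N := z |: [set y in U | h z y].
have sNU : N \subset U.
  by apply/subsetP => y /setU1P[->//|]; rewrite inE => /andP[].
have cN : #|N| <= k.
  rewrite cardsU1 inE h_irr andbF -deg_card (leq_trans _ (lt_k z zU)) //.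
  by rewrite ltnS deg_sub.
have [|R sRU cR] := @subset_of_size (U :\: N) (k - #|N|).
  have := cardsID N U; rewrite (setIidPr sNU) cU; nia.
pose W := N :|: R.
have sWU : W \subset U by rewrite subUset sNU (subset_trans sRU) ?subsetDl.
have cW : #|W| = k.
  rewrite cardsU (_ : N :&: R = set0) ?cards0 ?cR; first by rewrite subn0 subnKC.
  apply/setP => y; rewrite in_set0 in_setI; apply/negP => /andP[yN /(subsetP sRU)].
  by rewrite inE yN.
have [|x|//|S [sS iS cS le_S]] := IHi (U :\: W).
- have := cardsID W U; rewrite (setIidPr sWU) cU cW; lia.
- by rewrite inE => /andP[_]; apply: lt_k.
- by rewrite (subset_trans _ sUA) ?subsetDl.
have zS : z \notin S.
  by apply/negP => /(subsetP sS); rewrite !inE eqxx.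
exists (z |: S); split.
- by rewrite subUset sub1set zU (subset_trans sS) ?subsetDl.
- apply: indepU1 => // y /(subsetP sS); rewrite !inE !negb_or => /andP[/andP[/andP[_ nzy] _] yU].
  by move: nzy; rewrite yU => /negbTE.
- by rewrite cardsU1 zS cS.
rewrite (big_setID W) /= (setIidPr sWU) big_setU1 //= mulnDr leq_add //.
by rewrite -cW -sum_nat_const leq_sum // => y /(subsetP sWU); apply: z_max.
Qed.

(** * Partitions into independent sets of equal size *)

Definition splits r A : Prop := exists P : {set {set T}},
  partition P A /\ forall S, S \in P -> indep S /\ #|S| = r.

Lemma splits_add r A S : 0 < r -> S \subset A -> indep S -> #|S| = r ->
  splits r (A :\: S) -> splits r A.
Proof.
move=> r_gt0 sSA iS cS [P [partP hP]]; exists (S |: P); split; last first.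
  by move=> R /setU1P[->|/hP].
have S_neq0 : S != set0 by rewrite -cards_eq0 cS -lt0n.
rewrite -[A in partition _ A](setID A S) (setIidPr sSA); apply: partitionU1 => //.
by rewrite disjoints_subset setCD subsetUr.
Qed.

(** Removing [S] destroys twice [deg A v] edges, or only [deg A v] edges but with a strict drop of
    the maximum degree; either gain suffices for the induction. *)
Lemma indep_max_degree s A v : v \in A ->
    (forall x, x \in A -> deg A x <= deg A v) ->
    pairs A A < 2 * deg A v + 2 * coturan (#|A| - 1 - deg A v) s ->
  exists S, [/\ S \subset A, indep S, #|S| = s.+2
    & 2 * deg A v <= \sum_(x in S) deg A x \/
      deg A v <= \sum_(x in S) deg A x /\
      forall x, x \in A :\: S -> deg (A :\: S) x < deg A v].
Proof.
move=> vA v_max tb_v.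
pose two S := [exists x in S, exists y in S,
  [&& x != y, deg A x == deg A v & deg A y == deg A v]].
have [/existsP[S /and4P[sSA iS /eqP cS]]|/existsPn no_two] :=
    boolP [exists S : {set T}, [&& S \subset A, indep S, #|S| == s.+2 & two S]].
  move=> /exists_inP[x xS /exists_inP[y yS /and3P[xy /eqP dx /eqP dy]]].
  exists S; split=> //; left.
  rewrite (big_setD1 x) //= (big_setD1 y) /= ?inE 1?eq_sym ?xy //.
  by rewrite dx dy; lia.
pose Q := (A :\ v) :\: [set y in A | h v y].
have cQ : #|Q| = #|A| - 1 - deg A v.
  have := cardsD1 v A; rewrite vA.
  have := cardsID [set y in A | h v y] (A :\ v); rewrite (setIidPr _) -?deg_card.
    by rewrite -/Q; lia.
  apply/subsetP => y; rewrite !inE => /andP[-> hvy].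
  by rewrite andbT; apply: contraTneq hvy => ->; rewrite h_irr.
(* No edge at [v] lies inside [Q], so [tb_v] leaves fewer than [coturan #|Q| s] edges there. *)
have [|I [sIQ iI cI]] := @turan_indep s Q.
  have eq_v := @pairs_remove_indep [set v] A (indep1 v).
  rewrite sub1set big_set1 vA in eq_v; have {}eq_v := eq_v isT.
  have := @pairs_sub Q (A :\ v) (subsetDl _ _).
  by rewrite cQ; lia.
have Qv y : y \in I -> [/\ y \in A, y != v & h v y = false].
  move=> /(subsetP sIQ); rewrite !inE => /andP[nhy /andP[-> yA]].
  by move: nhy; rewrite yA => /negbTE.
have vI : v \notin I by apply/negP => /Qv[_]; rewrite eqxx.
have cS : #|v |: I| = s.+2 by rewrite cardsU1 vI cI.
have iS : indep (v |: I) by apply: indepU1 => // y /Qv[].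
have sSA : v |: I \subset A.
  by rewrite subUset sub1set vA; apply/subsetP => y /Qv[].
exists (v |: I); split=> //; right; split=> [|x].
  by rewrite big_setU1 //= leq_addr.
(* An [x] keeping degree [deg A v] would have maximum degree and no neighbour in [v |: I]. *)
rewrite inE => /andP[xS xA]; rewrite ltnNge; apply/negP => le_v.
have eq_x := deg_split x sSA; have le_x := v_max x xA.
have x0 : deg (v |: I) x = 0 by lia.
have x_far y : y \in v |: I -> h x y = false.
  move=> yS; move/eqP: x0; rewrite deg_card cards_eq0 => /eqP/setP/(_ y).
  by rewrite !inE; move: yS; rewrite !inE => ->.
have /card_gt0P[u uI] : 0 < #|I| by rewrite cI.
move: xS; rewrite !inE negb_or => /andP[xv xI].
(* Exchanging [u] for [x] would give two vertices of maximum degree. *)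
case/negP: (no_two (x |: (v |: I) :\ u)).
have vu : v != u by apply: contraNneq vI => ->.
rewrite subUset sub1set xA (subset_trans (subsetDl _ _) sSA) /=; apply/and3P; split.
- apply: indepU1 => [|y]; last by rewrite inE => /andP[_ /x_far].
  apply/indepP => y z; rewrite !in_setD => /andP[_ yS] /andP[_ zS].
  by apply: (indepP _ iS).
- rewrite cardsU1 !inE (negbTE xv) (negbTE xI) andbF.
  by have := cardsD1 u (v |: I); rewrite !inE uI orbT cS => ->.
- apply/exists_inP; exists x; first by rewrite !inE eqxx.
  apply/exists_inP; exists v; first by rewrite !inE eqxx vu orbT.
  by rewrite xv eqxx andbT eqn_leq le_x (leq_trans le_v) ?deg_sub ?subsetDl.
Qed.

(** The main induction, with both bounds doubled; [k * s.+2 - 1 - deg A x] is the number of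
    non-neighbours of [x]. The vertex bound is carried for [1 < k], the range of
    [coturan_high_degree]. *)
Lemma splits_sparse k s A : 0 < s -> 0 < k -> #|A| = k * s.+2 ->
    pairs A A < k * k.+1 ->
    (1 < k -> forall x, x \in A ->
      pairs A A < 2 * deg A x + 2 * coturan (k * s.+2 - 1 - deg A x) s) ->
  splits s.+2 A.
Proof.
move=> s_gt0; elim: k A => // k IHk A _ cA lt_pairs tb_pairs.
have [k0|k_gt0] := posnP k.
  (* Here [pairs A A < 2], whereas a single edge would contribute 2. *)
  have iA : indep A.
    apply/indepP => x y xA yA; apply/negP => hxy.
    have : pairs A A >= 2 * deg A x.
      have := @pairs_remove_indep [set x] A (indep1 x).
      rewrite sub1set big_set1 => ->//; lia.
    have : 0 < deg A x by rewrite deg_card card_gt0; apply/set0Pn;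
      exists y; rewrite inE yA.
    by move: lt_pairs; rewrite k0; lia.
  apply: (@splits_add _ _ A) => //; first by rewrite cA k0 mul1n.
  exists set0; rewrite setDv; split; last by move=> S; rewrite inE.
  by rewrite partition_set0.
have {}tb_pairs := tb_pairs k_gt0.
suff [S [sSA iS cS lt_S tb_S]] : exists S, [/\ S \subset A, indep S, #|S| = s.+2,
    pairs (A :\: S) (A :\: S) < k * k.+1
  & 1 < k -> forall x, x \in A :\: S -> pairs (A :\: S) (A :\: S) <
      2 * deg (A :\: S) x + 2 * coturan (k * s.+2 - 1 - deg (A :\: S) x) s].
  apply: (splits_add _ sSA iS cS) => //; apply: IHk => //.
  have := cardsID S A; rewrite (setIidPr sSA) cS cA; lia.
have cAS S : S \subset A -> #|S| = s.+2 -> #|A :\: S| = k * s.+2.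
  by move=> sSA cS; have := cardsID S A; rewrite (setIidPr sSA) cS cA; lia.
have /set0Pn[x0 x0A] : A != set0 by rewrite -cards_eq0 cA.
case: (@arg_maxnP _ x0 (fun x => x \in A) (deg A) x0A) => v vA v_max.
have [le_k|lt_k] := leqP (deg A v) k.
  have cA' : #|A| = s.+2 * k.+1 by rewrite mulnC.
  have ltA x : x \in A -> deg A x < k.+1 by move=> /v_max; lia.
  have [S [sSA iS cS le_S]] := greedy_indep (ltn0Sn k) cA' ltA (subxx A).
  have eqS := pairs_remove_indep iS sSA.
  (* At most the fraction [(k - 1) / (k + 1)] of the edges survives, and
     [(k - 1) * (k + 2) < k * (k + 1)]. *)
  have lt_S : pairs (A :\: S) (A :\: S) < k * k.+1.
    move: le_S eqS; rewrite -pairsE; nia.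
  exists S; split=> // k_gt1 x xAS.
  have d_le : deg (A :\: S) x <= k.
    apply: leq_trans (deg_sub x (subsetDl A S)) _.
    by apply: leq_trans (v_max _ _) le_k; move: xAS; rewrite inE => /andP[].
  have := deg_lt_card xAS; rewrite (cAS _ sSA cS) => lt_d.
  have := @coturan_low_degree k s (k * s.+2 - 1 - deg (A :\: S) x) s_gt0 k_gt0.
  nia.
have [S [sSA iS cS deg_S]] : exists S, [/\ S \subset A, indep S, #|S| = s.+2
    & 2 * deg A v <= \sum_(x in S) deg A x \/
      deg A v <= \sum_(x in S) deg A x /\
      forall x, x \in A :\: S -> deg (A :\: S) x < deg A v].
  apply: indep_max_degree => //; move: (tb_pairs v vA); rewrite cA; lia.
have eqS := pairs_remove_indep iS sSA.
(* At least [deg A v >= k + 1] edges go, and [(k + 1) * (k + 2) - 2 * (k + 1) = k * (k + 1)]. *)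
have lt_S : pairs (A :\: S) (A :\: S) < k * k.+1.
  by case: deg_S => [|[]]; lia.
exists S; split=> // k_gt1 x xAS.
have xA : x \in A by move: xAS; rewrite inE => /andP[].
have lt_d := deg_lt_card xAS; rewrite (cAS _ sSA cS) in lt_d.
have le_d : deg (A :\: S) x <= deg A v.
  exact: leq_trans (deg_sub x (subsetDl A S)) (v_max _ xA).
have := tb_pairs v vA.
set d := deg (A :\: S) x in lt_d le_d *.
have [p def_p] : exists p, d + p + 1 = k * s.+2.
  by exists (k * s.+2 - 1 - d); lia.
have -> : k * s.+2 - 1 - d = p by lia.
have := @coturan_high_degree k s p d s_gt0 k_gt1 def_p.
have lt_v := deg_lt_card vA; rewrite cA in lt_v.
(* Let [x], with [d] neighbours and [p] non-neighbours left, violate the vertex bound. Comparison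
   with the bound at [v] yields [d <= p + p %/ s], and then [coturan_high_degree] contradicts the
   edge bound for [A]. *)
rewrite ltnNge => N1 lt_v_tb; apply/negP => bad.
case: deg_S => [le2|[le1 lt_dS]].
  have le_D : coturan (k.+1 * s.+2 - 1 - deg A v) s <= coturan (p + s).+2 s.
    by apply: leq_coturan; lia.
  rewrite !coturanS coturan_shift // -addSn !divnDr // divnn s_gt0 in le_D.
  have : p.+1 %/ s <= p %/ s + 1.
    by rewrite -(_ : (p + s) %/ s = p %/ s + 1) ?leq_div2r ?divnDr ?divnn ?s_gt0 //; lia.
  have := leq_div p s.
  move: (p %/ s) (p.+1 %/ s) (coturan p s) N1 le_D bad => z z' tp N1 le_D bad le_zp le_z'.
  (* The estimates give [2 * d <= p + 2 * z + 2], hence [d <= p + z] once [p >= 2]; a smaller [p] is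
     impossible because [d + p + 1 >= 6]. *)
  have : 6 <= k * s.+2 by apply: (@leq_mul 2 3 k s.+2).
  have : d <= p + z by lia.
  by move=> /N1; lia.
have {}lt_dS := lt_dS _ xAS.
have le_D : coturan (k.+1 * s.+2 - 1 - deg A v) s <= coturan (p + s).+1 s.
  by apply: leq_coturan; lia.
rewrite coturanS coturan_shift // divnDr // divnn s_gt0 in le_D.
move: (p %/ s) (coturan p s) N1 le_D bad => z tp N1 le_D bad.
have : d <= p + z by lia.
by move=> /N1; lia.
Qed.

End EquitableColoring.

(** * Degrees, complements and packings of graphs *)

Lemma min_degree_le (G : sgraph) (x : G) : min_degree G <= degree x.
Proof.
rewrite /min_degree; have := mem_index_enum x.
elim: (index_enum G) => // y s IHs; rewrite inE big_cons geq_min.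
by case/predU1P => [<-|/IHs->]; rewrite ?leqnn ?orbT.
Qed.

(** The condition [D <= #|G|] handles the default value of the iterated minimum. *)
Lemma min_degree_ge (G : sgraph) D :
  D <= #|G| -> (forall x : G, D <= degree x) -> D <= min_degree G.
Proof.
move=> le_D D_deg; rewrite /min_degree.
by elim/big_ind: _ => // x y le_x le_y; rewrite leq_min le_x.
Qed.

(** Ordered adjacent pairs are grouped by the edge they span; each fibre consists of the two
    orientations. *)
Lemma handshake (G : sgraph) : 2 * num_edges G = \sum_(x : G) degree x.
Proof.
pose f (p : G * G) := [set p.1; p.2].
have -> : \sum_(x : G) degree x = \sum_(p : G * G | adj p.1 p.2) 1.
  rewrite -(pair_big_dep xpredT (@adj G) (fun _ _ => 1)) /=.
  by apply: eq_bigr => x _; rewrite sum1_card /degree cardsE.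
rewrite (partition_big f (mem (edges G))) /=; last first.
  move=> [x y] /= hxy; rewrite inE; apply/existsP; exists x.
  by apply/existsP; exists y; rewrite hxy /=.
rewrite mulnC /num_edges -sum_nat_const; apply: eq_bigr => E.
rewrite inE => /existsP[x /existsP[y /andP[hxy /eqP->]]].
have xy : x != y by apply: contraTneq hxy => ->; rewrite adj_irr.
rewrite sum1_card (eq_card (B := [set (x, y); (y, x)])).
  by rewrite cards2 xpair_eqE (negbTE xy).
move=> [a b]; rewrite !inE unfold_in /= /f /= !xpair_eqE.
apply/andP/orP => [[hab /eqP/setP eab]|[] /andP[/eqP-> /eqP->]]; last 2 first.
- by rewrite hxy.
- by rewrite adj_sym hxy setUC.
have ab : a != b by apply: contraTneq hab => ->; rewrite adj_irr.
have := eab a; have := eab b; rewrite !inE !eqxx orbT /=.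
move=> /esym/orP[]/eqP eb /esym/orP[]/eqP ea; rewrite ea eb ?eqxx in ab *; auto.
Qed.

Definition nadj (G : sgraph) : rel G := fun x y => (x != y) && ~~ adj x y.

Lemma nadj_sym (G : sgraph) : symmetric (@nadj G).
Proof. by move=> x y; rewrite /nadj eq_sym adj_sym. Qed.

Lemma nadj_irr (G : sgraph) : irreflexive (@nadj G).
Proof. by move=> x; rewrite /nadj eqxx. Qed.

Lemma sum_eq_op (T : finType) (x : T) : \sum_(y : T) (x == y) = 1.
Proof.
rewrite (bigD1 x) //= eqxx big1 // => y; by rewrite eq_sym => /negbTE->.
Qed.

Lemma degreeE (G : sgraph) (x : G) : degree x = \sum_(y : G) adj x y.
Proof.
rewrite /degree -sum1_card big_mkcond; apply: eq_bigr => y _.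
by rewrite inE; case: (adj x y).
Qed.

Lemma deg_nadj (G : sgraph) (x : G) : deg (@nadj G) setT x + degree x + 1 = #|G|.
Proof.
rewrite -(sum_eq_op x) degreeE /deg (eq_bigl xpredT) => [|y]; last by rewrite inE.
rewrite -!big_split -sum1_card; apply: eq_bigr => y _ /=.
by rewrite /nadj; case: eqVneq => [->|_]; rewrite ?adj_irr //=; case: (adj x y).
Qed.

Lemma pairs_nadj (G : sgraph) :
  pairs (@nadj G) setT setT + 2 * num_edges G + #|G| = #|G| * #|G|.
Proof.
rewrite handshake pairsE (eq_bigl xpredT) => [|y]; last by rewrite inE.
rewrite -[X in _ + _ + X]sum1_card -!big_split -sum_nat_const /=.
by apply: eq_bigr => x _; apply: deg_nadj.
Qed.

(** Vertex [m] adds itself and, in both orders, its [m %/ s] earlier classmates, which is the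
    increment of [coturan]. *)
Lemma sum_ord_eqmod m s : 0 < s ->
  \sum_(i < m) \sum_(j < m) (i %% s == j %% s) = m + 2 * coturan m s.
Proof.
move=> s_gt0; elim: m => [|m IHm]; first by rewrite big_ord0 coturan0.
have col : \sum_(i < m) (i %% s == m %% s) = m %/ s.
  have := @turan_class_size m s (m %% s) (ltn_pmod m s_gt0).
  rewrite ltnn addn0 => <-; rewrite -sum1_card [RHS]big_mkcond.
  by apply: eq_bigr => i _; rewrite inE; case: (_ == _).
rewrite big_ord_recr /= big_ord_recr /= eqxx coturanS.
rewrite (eq_bigr (fun i : 'I_m =>
    \sum_(j < m) (i %% s == j %% s) + (i %% s == m %% s))).
  rewrite big_split /= IHm col.
  rewrite (eq_bigr (fun i : 'I_m => nat_of_bool (i %% s == m %% s))) ?col; first lia.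
  by move=> i _; rewrite eq_sym.
by move=> i _; rewrite big_ord_recr.
Qed.

Lemma num_edges_turan m s : 0 < s ->
  2 * num_edges (turan_graph m s) + m + 2 * coturan m s = m * m.
Proof.
move=> s_gt0; rewrite handshake -addnA -sum_ord_eqmod // -big_split /=.
rewrite (_ : m * m = \sum_(i < m) \sum_(j < m) 1); last first.
  by rewrite !sum_nat_const card_ord muln1.
apply: eq_bigr => i _; rewrite degreeE -big_split; apply: eq_bigr => j _.
by rewrite /= /turan_adj; case: (_ == _).
Qed.

Lemma packing_of_splits (G : sgraph) r :
  splits (@nadj G) r setT -> has_perfect_packing (complete_graph r) G.
Proof.
case=> P [partP hP].
have cP (i : 'I_#|P|) : #|enum_val i| = r by case: (hP _ (enum_valP i)).
have f_in i (j : 'I_r) : enum_val (cast_ord (esym (cP i)) j) \in enum_val i.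
  exact: enum_valP.
exists #|P|, (fun i j => enum_val (cast_ord (esym (cP i)) j)); split.
- move=> i; split=> [j j' /enum_val_inj/cast_ord_inj //|j j' /= jj'].
  have [/indepP iS _] := hP _ (enum_valP i).
  have := iS _ _ (f_in i j) (f_in i j'); rewrite /nadj.
  by case: eqVneq => [/enum_val_inj/cast_ord_inj/eqP|_ /negbFE //]; rewrite (negbTE jj').
- move=> i i' ii'; apply/pred0P => x /=; apply/negP => /andP[/codomP[j xj] /codomP[j' xj']].
  have /and3P[_ /trivIsetP triv _] := partP.
  have := triv _ _ (enum_valP i) (enum_valP i'); rewrite (inj_eq enum_val_inj) => /(_ ii').
  by move=> /pred0P/(_ x); rewrite /= {1}xj xj' !f_in.
- move=> x; have /and3P[/eqP cov _ _] := partP.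
  have : x \in cover P by rewrite cov.
  case/bigcupP => S SP xS; pose i := enum_rank_in SP S.
  have iS : enum_val i = S by apply: enum_rankK_in.
  have xi : x \in enum_val i by rewrite iS.
  exists i; apply/codomP; exists (cast_ord (cP i) (enum_rank_in xi x)).
  by rewrite cast_ordK enum_rankK_in.
Qed.

(** Each clique copy contains at most one vertex of [K], so a packing has at least [#|K|] disjoint
    copies of [r] vertices each. *)
Lemma packing_indep (G : sgraph) r (K : {set G}) :
  {in K &, forall x y, ~~ adj x y} -> has_perfect_packing (complete_graph r) G ->
  #|K| * r <= #|G|.
Proof.
move=> iK [k [f [emb dis cov]]].
have le_k : k * r <= #|G|.
  have := @leq_card _ _ (fun p : 'I_k * 'I_r => f p.1 p.2).
  rewrite card_prod !card_ord; apply=> -[i a] [j b] /= eq_f.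
  have [eij|ij] := eqVneq i j.
    by rewrite -eij in eq_f *; rewrite (proj1 (emb i) _ _ eq_f).
  have /pred0P/(_ (f i a)) := dis i j ij.
  by rewrite /= codom_f eq_f codom_f.
rewrite (leq_trans _ le_k) // leq_mul2r; apply/orP; right.
have ex_i (x : G) : exists i, x \in codom (f i) := cov x.
pose c x := xchoose (ex_i x).
have c_in x : x \in codom (f (c x)) := xchooseP (ex_i x).
suff c_inj : {in K &, injective c}.
  by rewrite -(card_in_imset c_inj) -[leqRHS]card_ord max_card.
move=> x y xK yK eq_c; apply/eqP/negPn/negP => xy.
have /codomP[a xa] := c_in x; have /codomP[b yb] := c_in y.
rewrite -eq_c in yb; have /negP := iK _ _ xK yK; apply.
rewrite xa yb; apply: (proj2 (emb (c x))); apply: contraNneq xy => ab.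
by rewrite xa yb ab.
Qed.

(** * The two extremal graphs, described by their non-adjacency relations *)

Section Cograph.

Variables (n : nat) (c : rel nat).
Hypothesis c_sym : symmetric c.

(** The relation [c] may hold on the diagonal, which lets its double sums factor; the terms [c i i]
    below correct for this. *)
Definition coadj : rel 'I_n := fun i j => (i != j) && ~~ c i j.

Lemma coadj_sym : symmetric coadj.
Proof. by move=> i j; rewrite /coadj eq_sym c_sym. Qed.

Lemma coadj_irr : irreflexive coadj.
Proof. by move=> i; rewrite /coadj eqxx. Qed.

Definition cograph : sgraph := SGraph coadj_sym coadj_irr.

Lemma degree_cograph (i : cograph) :
  degree i + \sum_(j < n) c i j + 1 = n + c i i.
Proof.
rewrite -(sum_eq_op i) degreeE -2!big_split /=.
have -> : n + c i i = \sum_(j < n) (1 + (i == j) * c i i).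
  by rewrite big_split /= -big_distrl /= sum_eq_op mul1n sum1_card card_ord.
apply: eq_bigr => j _; rewrite /coadj.
by case: eqVneq => [->|_] /=; case: (c _ _).
Qed.

Lemma num_edges_cograph :
  2 * num_edges cograph + \sum_(i < n) \sum_(j < n) c i j + n =
  n * n + \sum_(i < n) c i i.
Proof.
have : \sum_(i : cograph) (degree i + \sum_(j < n) c i j + 1) = \sum_(i < n) (n + c i i).
  by apply: eq_bigr => i _; apply: degree_cograph.
by rewrite handshake !big_split /= sum1_card sum_nat_const card_ord.
Qed.

End Cograph.

Lemma sum_ord_ltn n a (F : nat -> nat) : a <= n ->
  \sum_(i < n) (i < a) * F i = \sum_(i < a) F i.
Proof.
move=> le_an; rewrite (big_ord_widen n F le_an) [RHS]big_mkcond.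
by apply: eq_bigr => i _; case: (i < a); rewrite ?mul1n.
Qed.

Lemma sum_ord_ltn1 n a : a <= n -> \sum_(i < n) (i < a) = a.
Proof.
move=> le_an; rewrite -[RHS]card_ord -sum1_card -(sum_ord_ltn (fun=> 1) le_an).
by apply: eq_bigr => i _; rewrite muln1.
Qed.

Lemma sum_ord_gtn n a : a < n -> \sum_(i < n) (a < i) + a.+1 = n.
Proof.
move=> lt_an; rewrite -{2}(sum_ord_ltn1 lt_an) -big_split -[RHS]card_ord -sum1_card.
by apply: eq_bigr => i _ /=; rewrite ltnS; case: leqP.
Qed.

Lemma sum_ord_eq n a (F : nat -> nat) : a < n ->
  \sum_(i < n) (i == a :> nat) * F i = F a.
Proof.
move=> lt_an; rewrite (bigD1 (Ordinal lt_an)) //= eqxx mul1n big1 ?addn0 // => i.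
by rewrite -val_eqE /= => /negbTE->.
Qed.

Section CliqueComplement.

Variables (n k : nat).
Hypothesis lt_kn : k < n.

(** The vertices [0, .., k] become an independent set; for [n = k * r] it is one vertex too large
    for a packing, and the graph attains the first term of [g]. *)
Definition low_rel : rel nat := fun i j => (i <= k) && (j <= k).

Lemma low_rel_sym : symmetric low_rel.
Proof. by move=> i j; rewrite /low_rel andbC. Qed.

Definition clique_complement := cograph n low_rel_sym.

Lemma num_edges_clique_complement :
  2 * num_edges clique_complement + k * k.+1 + n = n * n.
Proof.
have := num_edges_cograph n low_rel_sym; rewrite -/clique_complement.
have -> : \sum_(i < n) low_rel i i = k.+1.
  by rewrite -[RHS](sum_ord_ltn1 lt_kn); apply: eq_bigr => i _; rewrite /low_rel andbb.
have -> : \sum_(i < n) \sum_(j < n) low_rel i j = k.+1 * k.+1.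
  rewrite -{1 2}(sum_ord_ltn1 lt_kn) big_distrl; apply: eq_bigr => i _.
  by rewrite big_distrr; apply: eq_bigr => j _; rewrite /low_rel -mulnb.
lia.
Qed.

Lemma min_degree_clique_complement D : D + k < n -> D <= min_degree clique_complement.
Proof.
move=> lt_D; apply: min_degree_ge => [|i]; first by rewrite card_ord; lia.
have := degree_cograph i; rewrite /low_rel andbb.
have : \sum_(j < n) ((i <= k) && (j <= k)) <= k.+1 * (i <= k).
  rewrite -(sum_ord_ltn1 lt_kn) big_distrl /=; apply: leq_sum => j _.
  by rewrite -mulnb mulnC.
rewrite -/clique_complement; case: (i <= k); lia.
Qed.

Lemma no_packing_clique_complement r : n < k.+1 * r ->
  ~ has_perfect_packing (complete_graph r) clique_complement.
Proof.
move=> lt_n; pose K := [set i : clique_complement | i <= k].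
have cK : #|K| = k.+1.
  rewrite -[RHS](sum_ord_ltn1 lt_kn) -sum1_card big_mkcond.
  by apply: eq_bigr => i _; rewrite inE ltnS; case: ifP.
have iK : {in K &, forall x y, ~~ adj x y}.
  by move=> i j; rewrite !inE /= /coadj /low_rel => -> ->; rewrite andbF.
by move=> /(packing_indep iK); rewrite cK card_ord leqNgt lt_n.
Qed.

End CliqueComplement.

Section TuranNeighbourhood.

Variables (n D s : nat).
Hypotheses (lt_Dn : D < n) (s_gt0 : 0 < s).

(* Vertex [D] has neighbourhood [{0, .., D-1}], which induces [T(D, s)]; all
   other vertices are adjacent to everything but [D]. *)
Definition pinned_rel : rel nat := fun i j =>
  [|| [&& i < D, j < D & i %% s == j %% s], (i == D) && (D < j) | (j == D) && (D < i)].

Lemma pinned_rel_sym : symmetric pinned_rel.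
Proof.
move=> i j; rewrite /pinned_rel [i %% s == _]eq_sym andbCA; congr orb.
by rewrite orbC.
Qed.

Definition pinned_graph := cograph n pinned_rel_sym.

Lemma pinned_relE i j : pinned_rel i j =
  (i < D) * ((j < D) * (i %% s == j %% s)) + (i == D) * (D < j)
  + (D < i) * (j == D) :> nat.
Proof.
by rewrite /pinned_rel; case: (ltngtP i D); case: (ltngtP j D); case: (_ %% _ == _).
Qed.

Lemma sum_pinned_rel (i : nat) : \sum_(j < n) pinned_rel i j =
  (i < D) * \sum_(j < D) (i %% s == j %% s) + (i == D) * (n - 1 - D) + (D < i).
Proof.
rewrite (eq_bigr _ (fun (j : 'I_n) _ => pinned_relE i j)) !big_split -!big_distrr /=.
rewrite (sum_ord_ltn (fun j => i %% s == j %% s) (ltnW lt_Dn)).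
have <- : \sum_(j < n) (D < j) = n - 1 - D by have := sum_ord_gtn lt_Dn; lia.
have -> : \sum_(j < n) (j == D :> nat) = 1; last by rewrite muln1.
rewrite -(sum_ord_eq (fun=> 1) lt_Dn); by apply: eq_bigr => j _; rewrite muln1.
Qed.

Lemma pinned_rel_diag i : pinned_rel i i = (i < D).
Proof. by rewrite /pinned_rel eqxx andbT andbb; case: ltngtP. Qed.

Lemma num_edges_pinned :
  2 * num_edges pinned_graph + 2 * coturan D s + 2 * (n - 1 - D) + n = n * n.
Proof.
have := num_edges_cograph n pinned_rel_sym; rewrite -/pinned_graph.
rewrite (eq_bigr _ (fun (i : 'I_n) _ => sum_pinned_rel i)) !big_split /=.
rewrite (sum_ord_ltn (fun i => \sum_(j < D) (i %% s == j %% s)) (ltnW lt_Dn)).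
rewrite sum_ord_eqmod // (sum_ord_eq (fun=> n - 1 - D) lt_Dn).
have -> : \sum_(i < n) pinned_rel i i = D.
  rewrite -[RHS](sum_ord_ltn1 (ltnW lt_Dn)).
  by apply: eq_bigr => i _; rewrite pinned_rel_diag.
have := sum_ord_gtn lt_Dn; move: (\sum_(i < n) (D < i)) => z; lia.
Qed.

(** The second hypothesis says that a largest class of [T(D, s)] has at most [n - D] vertices, which
    is what the vertices below [D] require; vertices above [D] have degree [n - 2]. *)
Lemma min_degree_pinned : D.+1 < n -> D + D %/ s + (0 < D %% s) <= n ->
  D <= min_degree pinned_graph.
Proof.
move=> lt_D le_n; apply: min_degree_ge => [|i]; first by rewrite card_ord ltnW.
have := degree_cograph i; rewrite sum_pinned_rel pinned_rel_diag -/pinned_graph.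
have := @turan_class_size D s (i %% s) (ltn_pmod i s_gt0).
rewrite -sum1_card big_mkcond => eq_i.
have {eq_i} -> : \sum_(j < D) (i %% s == j %% s) = D %/ s + (i %% s < D %% s).
  rewrite -eq_i; apply: eq_bigr => j _; rewrite inE eq_sym; by case: (_ == _).
have : (i %% s < D %% s) <= (0 < D %% s)
  by case: (D %% s) => [|d]; rewrite ?ltn0 ?leq_b1.
by move: (i %% s < D %% s) (0 < D %% s) le_n => b b'; case: (ltngtP i D) => _; lia.
Qed.

(** The copy through vertex [D] would place [s.+1] pairwise adjacent vertices in its [s]-partite
    neighbourhood; the residues modulo [s] give the pigeonholes. *)
Lemma no_packing_pinned : ~ has_perfect_packing (complete_graph s.+2) pinned_graph.
Proof.
case=> k [f [emb _ cov]].
have [i /codomP[a eq_a]] := cov (Ordinal lt_Dn).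
have far b : a != b -> f i b < D.
  move=> /(proj2 (emb i) a b); rewrite -eq_a /= /coadj -val_eqE /pinned_rel /=.
  by rewrite ltnn eqxx /= andbF orbF; case: ltngtP.
pose c b : 'I_s := Ordinal (ltn_pmod (f i b) s_gt0).
have c_inj : {in [set~ a] &, injective c}.
  move=> b b'; rewrite !inE ![_ == a]eq_sym => /far lt_b /far lt_b' [eq_c].
  apply/eqP/negPn/negP => /(proj2 (emb i) b b').
  by rewrite /= /coadj /pinned_rel lt_b lt_b' eq_c eqxx andbF.
have := max_card (c @: [set~ a]); rewrite card_in_imset // cardsC1 !card_ord.
by rewrite ltnn.
Qed.

End TuranNeighbourhood.

(** * Translation of [g] to the complement, sufficiency and sharpness *)

Theorem theorem1p4 (n r D : nat) (hr : 3 <= r) (hrn : r %| n)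
    (hD1 : r - 1 <= D) (hD2 : D + 1 <= ((r - 1) * n) %/ r) :
  (forall G : sgraph, #|G| = n -> D <= min_degree G ->
     g n r D < num_edges G -> has_perfect_packing (complete_graph r) G) /\
  (exists G' : sgraph,
     [/\ #|G'| = n, D <= min_degree G', num_edges G' = g n r D
       & ~ has_perfect_packing (complete_graph r) G']).
Proof.
case/dvdnP: hrn hD2 => k nE; rewrite nE mulnA mulnK -?nE; last lia.
have [s def_r] : exists s, r = s.+2 by exists (r - 2); lia.
move: hr hD1 nE; rewrite {}def_r => hr hD1 nE hD2.
have s_gt0 : 0 < s by lia.
have k_gt0 : 0 < k by lia.
have lt_n : D + k < n by rewrite nE; lia.
(* The graph behind the second term misses the [coturan D s] pairs inside Turán classes and the
   [n - 1 - D] non-edges at vertex [D]. *)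
have edges_D : D * (n - D) + 'C(n - 1 - D, 2) + num_edges (turan_graph D s)
    + coturan D s + (n - 1 - D) = 'C(n, 2).
  have := num_edges_turan D s_gt0; have := bin2_double n.
  have := bin2_double (n - 1 - D).
  have [m def_n] : exists m, n = D + m.+2 by exists (n - D - 2); lia.
  have -> : n - 1 - D = m.+1 by lia.
  have -> : n - D = m.+2 by lia.
  rewrite def_n addnS /=.
  move: 'C(_, 2) 'C(_, 2) (num_edges _) (coturan D s) => a b c d.
  nia.
have gE : g n s.+2 D =
    maxn ('C(n, 2) - 'C(k.+1, 2)) ('C(n, 2) - (n - 1 - D) - coturan D s).
  by rewrite /g {2}nE mulnK // addn1 !subSS subn0; congr maxn; rewrite -edges_D !addnK.
have bin_n : n * n = 2 * 'C(n, 2) + n by rewrite bin2_double; nia.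
have bin_k : k * k.+1 = 2 * 'C(k.+1, 2) by rewrite bin2_double mulnC.
have le_kn : 'C(k.+1, 2) <= 'C(n, 2) by apply: leq_bin2l; lia.
split=> [G cG /leq_trans D_min lt_e|].
  have deg_le (x : G) : deg (@nadj G) setT x + D + 1 <= n.
    by have := deg_nadj x; have := D_min _ (min_degree_le x); rewrite cG; lia.
  have := pairs_nadj G; rewrite cG => pairsG.
  move: lt_e; rewrite gE gtn_max => /andP[lt1 lt2]; rewrite {}bin_n in pairsG.
  apply: packing_of_splits.
  apply: (splits_sparse (@nadj_sym G) (@nadj_irr G) s_gt0 k_gt0).
  - by rewrite cardsT cG nE.
  - rewrite bin_k; lia.
  move=> _ x _; rewrite -nE; have := deg_le x.
  set d := deg _ _ _ => le_d.
  (* The degree of [x] in [G] is [n - 1 - d], which is at least [D], so the bound at [D] passes to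
     [x]. *)
  have : coturan D s + (n - 1 - d) <= coturan (n - 1 - d) s + D
    by apply: coturan_add_mono; lia.
  lia.
have [le21|lt12] :=
  leqP ('C(n, 2) - (n - 1 - D) - coturan D s) ('C(n, 2) - 'C(k.+1, 2)).
  exists (clique_complement n k); split.
  - by rewrite card_ord.
  - by apply: min_degree_clique_complement; lia.
  - have := @num_edges_clique_complement n k; rewrite gE (maxn_idPl le21) bin_n bin_k; lia.
  - by apply: no_packing_clique_complement; [lia|rewrite nE ltn_pmul2r].
exists (pinned_graph n D s); split.
- by rewrite card_ord.
- apply: min_degree_pinned => //; try lia.
  (* A class larger than [n - D] forces [D >= k.+1 * s]; then [coturan D s] is at least
     ['C(k.+1, 2)], against [lt12], by which the second term of [g] is the larger one. *)
  rewrite leqNgt; apply/negP => lt_nD.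
  have le_D : k.+1 * s <= D.
    rewrite -leq_divRL //; have := leq_b1 (0 < D %% s).
    by move: (D %/ s) (0 < D %% s) lt_nD => q b; lia.
  have le_tb := leq_coturan s le_D.
  have : k * k.+1 <= s * (k * k.+1) by rewrite leq_pmull.
  have := coturan_mul k.+1 s_gt0; rewrite -mulnA (mulSn k k.+1) mulnDr.
  move: (coturan _ s) le_tb => u; lia.
- have := @num_edges_pinned n D s; rewrite gE (maxn_idPr (ltnW lt12)) bin_n; lia.
- by apply: no_packing_pinned; lia.
Qed.
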